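(* Let $\mathbb{K}$ be a non-Archimedean valued field with valuation $|\cdot|$, let $n$ be a positive integer, and let $p(z)=c_0+c_1z+\cdots+c_{n-1}z^{n-1}+z^n\in\mathbb{K}[z]$. If $\lambda\in\mathbb{K}$ is a zero of $p$, then at least one of the following holds: $$|\lambda|^2\leq |c_0|\max\{1,|c_j|\}\quad\text{for some } 1\leq j\leq n-2;$$ or $$|\lambda|\,|\lambda+c_{n-1}|\leq |c_0|;$$ or $$|\lambda|^2\leq \left(\max\{1,|c_j|\}\right)\left(\max\{1,|c_k|\}\right)\quad\text{for some } 1\leq j,k\leq n-2,\ j\neq k;$$ or $$|\lambda|\,|\lambda+c_{n-1}|\leq \max\{1,|c_j|\}\quad\text{for some } 1\leq j\leq n-2.$$
   Context: A non-Archimedean valued field is a field $\mathbb{K}$ with a map $|\cdot|:\mathbb{K}\to[0,\infty)$ such that $|x|=0$ iff $x=0$, $|xy|=|x||y|$, and $|x+y|\leq\max\{|x|,|y|\}$ for all $x,y\in\mathbb{K}$. *)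

(* Defs.v *)
From mathcomp Require Import all_boot all_order all_algebra.
From mathcomp Require Import reals.

Set Implicit Arguments.
Unset Strict Implicit.
Unset Printing Implicit Defensive.

Import Order.TTheory GRing.Theory Num.Theory.
Local Open Scope ring_scope.

(* The rank-one, multiplicatively written notion of valuation: an ultrametric
   absolute value with values in the nonnegative reals.  The trivial one is
   allowed. *)
Record nonarch_valuation (R : realType) (K : fieldType) (v : K -> R) : Prop :=
  NonarchValuation {
    nav_ge0 : forall x : K, 0 <= v x;
    nav_eq0 : forall x : K, v x = 0 <-> x = 0;
    nav_mul : forall x y : K, v (x * y) = v x * v y;
    nav_add : forall x y : K, v (x + y) <= Num.max (v x) (v y)
  }.

(* c_0 + c_1 X + ... + c_(n-1) X^(n-1) + X^n; the values c i with n <= i are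
   not used. *)
Definition monic_poly_of (K : fieldType) (n : nat) (c : nat -> K) : {poly K} :=
  (\sum_(i < n) c i *: 'X^i) + 'X^n.

(* Main.v *)
Require Import Defs.
From mathcomp Require Import all_boot all_order all_algebra.
From mathcomp Require Import reals.

Set Implicit Arguments.
Unset Strict Implicit.
Unset Printing Implicit Defensive.

Import Order.TTheory GRing.Theory Num.Theory.
Local Open Scope ring_scope.

(** The second alternative is immediate for lambda = 0, so let lambda != 0 and
    write L = |lambda|, a = |lambda + c_(n-1)|.  Grouping the two leading
    terms of p(lambda) = 0 gives
      lambda^(n-1) (lambda + c_(n-1)) = - sum_(j <= n-2) c_j lambda^j,
    and an ultrametric sum is at most its largest term, so some j <= n-2
    satisfies L^(n-1) a <= |c_j| L^j: this is [dominant_lower_term].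

    When L >= 1, dividing by L^j leaves a power of L with exponent
    n-1-j >= 1, which is at least L; hence L a <= |c_j|, which is the second
    alternative for j = 0 and the fourth for j >= 1.  For n = 2 the only
    possible index is j = 0, and the bound reads L a <= |c_0| whatever L is;
    for n = 1 the factor lambda + c_0 vanishes.

    When L < 1 and n >= 4, two distinct indices are available and the third
    alternative holds because its right-hand side is at least 1.  There remains
    n = 3 with L < 1.  If j = 1, cancel L.  If j = 0, then L^2 a <= |c_0|;
    either L a <= max(1, |c_1|), or L a > 1, and then L^2 <= L < L^2 a <= |c_0|
    gives the first alternative. *)

Lemma valuation_opp (R : realType) (K : fieldType) (v : K -> R)
    (hv : nonarch_valuation v) (x : K) : v (- x) = v x.
Proof.
apply/eqP; rewrite -(@eqrXn2 _ 2) ?(nav_ge0 hv) //.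
by rewrite !expr2 -!(nav_mul hv) mulrNN.
Qed.

Lemma valuation_exp (R : realType) (K : fieldType) (v : K -> R)
    (hv : nonarch_valuation v) (x : K) (m : nat) :
  v (x ^+ m) = v x ^+ m.
Proof.
have v1_neq0 : v 1 != 0 by apply/eqP => /(nav_eq0 hv)/eqP; rewrite oner_eq0.
have v1 : v 1 = 1 by apply: (mulfI v1_neq0); rewrite -(nav_mul hv) !mulr1.
by elim: m => [|m IHm]; rewrite ?expr0 // !exprS (nav_mul hv) IHm.
Qed.

Lemma valuation_sum_le_term (R : realType) (K : fieldType) (v : K -> R)
    (hv : nonarch_valuation v) (F : nat -> K) (m : nat) :
  exists2 j : nat, (j <= m)%N & v (\sum_(i < m.+1) F i) <= v (F j).
Proof.
elim: m => [|m [j le_jm IHj]]; first by exists 0%N; rewrite ?big_ord1.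
rewrite big_ord_recr /=; set S := \sum_(i < m.+1) _ in IHj *.
have := nav_add hv S (F m.+1).
rewrite le_max => /orP[le_S | le_F]; last by exists m.+1.
by exists j; [exact: leqW | exact: le_trans le_S IHj].
Qed.

(** The two leading terms of a vanishing monic polynomial factor as
    lambda^(m+1) (lambda + c_(m+1)), and they balance the sum of the terms of
    degree at most m, which one of these terms dominates. *)
Lemma dominant_lower_term (R : realType) (K : fieldType) (v : K -> R)
    (hv : nonarch_valuation v) (m : nat) (c : nat -> K) (lambda : K) :
    root (monic_poly_of m.+2 c) lambda ->
  exists2 j : nat, (j <= m)%N &
    v lambda ^+ m.+1 * v (lambda + c m.+1) <= v (c j) * v lambda ^+ j.
Proof.
move=> /rootP.
rewrite /monic_poly_of hornerD hornerXn horner_sum big_ord_recr /=.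
rewrite hornerZ hornerXn.
under eq_bigr do rewrite hornerZ hornerXn.
set S := \sum_(i < m.+1) _ => p_lambda.
have [j le_jm leS] := valuation_sum_le_term hv (fun i => c i * lambda ^+ i) m.
exists j => //; rewrite -!(valuation_exp hv) // -!(nav_mul hv).
suff -> : lambda ^+ m.+1 * (lambda + c m.+1) = - S by rewrite (valuation_opp hv).
apply/eqP; rewrite -addr_eq0 -[X in _ == X]p_lambda (exprSr _ m.+1) mulrDr.
by rewrite (mulrC (c _)) (addrC S) -addrA (addrC (_ * lambda)).
Qed.

Theorem theorem2p3 (R : realType) (K : fieldType) (v : K -> R)
    (hv : nonarch_valuation v) (n : nat) (n_gt0 : (0 < n)%N)
    (c : nat -> K) (lambda : K) (hroot : root (monic_poly_of n c) lambda) :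
  (exists j : nat, (1 <= j <= n - 2)%N /\
     v lambda ^+ 2 <= v (c 0%N) * Num.max 1 (v (c j)))
  \/ v lambda * v (lambda + c (n - 1)%N) <= v (c 0%N)
  \/ (exists j k : nat,
        [/\ (1 <= j <= n - 2)%N, (1 <= k <= n - 2)%N, j <> k &
          v lambda ^+ 2 <= Num.max 1 (v (c j)) * Num.max 1 (v (c k))])
  \/ (exists j : nat, (1 <= j <= n - 2)%N /\
        v lambda * v (lambda + c (n - 1)%N) <= Num.max 1 (v (c j))).
Proof.
have v0 : v 0 = 0 by apply/(nav_eq0 hv).
have v_ge0 := nav_ge0 hv.
have [lambda0 | lambda_neq0] := eqVneq lambda 0.
  by right; left; rewrite {1}lambda0 v0 mul0r.
have L_gt0 : 0 < v lambda.
  rewrite lt0r v_ge0 andbT.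
  by apply: contra_neq lambda_neq0 => /(nav_eq0 hv).
case: n n_gt0 hroot => [//|[_ hroot|m _ hroot]].
  have lambda_c0 : lambda + c 0%N = 0.
    move/rootP: hroot; rewrite /monic_poly_of big_ord1 expr0 alg_polyC.
    by rewrite hornerD hornerC hornerX addrC.
  by right; left; rewrite lambda_c0 v0 mulr0.
have [j le_jm le_dom] := dominant_lower_term hv hroot.
rewrite !subSS !subn0 in le_dom *.
set L := v lambda in L_gt0 le_dom *.
set a := v (lambda + c m.+1) in le_dom *.
have a_ge0 : 0 <= a by exact: v_ge0.
(* Cancelling L^j suffices whenever the remaining power of L is at least L. *)
have from_power : L <= L ^+ (m.+1 - j) -> L * a <= v (c j).
  move=> le_L; rewrite -(ler_pM2r (exprn_gt0 j L_gt0)).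
  apply: le_trans le_dom; rewrite -[in leRHS](subnK (leqW le_jm)) exprD.
  rewrite mulrAC; apply: ler_wpM2r => //.
  by apply: ler_wpM2r => //; exact/exprn_ge0/ltW.
have conclude : L * a <= v (c j) ->
    L * a <= v (c 0%N) \/
    (exists i, (1 <= i <= m)%N /\ L * a <= Num.max 1 (v (c i))).
  case: (j) le_jm => [_ le_c|i le_im le_c]; [by left | right].
  by exists i.+1; split=> //; rewrite le_max le_c orbT.
have finish : L <= L ^+ (m.+1 - j) -> _ := fun le_L => conclude (from_power le_L).
have [L_ge1 | L_lt1] := leP 1 L.
  have /finish[? | ?] : L <= L ^+ (m.+1 - j).
  - by rewrite subSn // -[leLHS]expr1; apply: ler_weXn2l.
  - by right; left.
  - by right; right; right.
case: m => [|[|m]] in hroot le_jm @a le_dom a_ge0 from_power conclude finish *.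
- have /finish[? | [i [/andP[]]]] : L <= L ^+ (1 - j).
  + by move: le_jm; rewrite leqn0 => /eqP->; rewrite subn0 expr1.
  + by right; left.
  + by case: i.
- case: j => [|j] in le_jm le_dom from_power conclude finish *; last first.
    have /finish[? | ?] : L <= L ^+ (2 - j.+1).
    + by move: le_jm; rewrite ltnS leqn0 => /eqP->.
    + by right; left.
    + by right; right; right.
  have [le_La | lt_La] := leP (L * a) (Num.max 1 (v (c 1%N))).
    by right; right; right; exists 1%N.
  left; exists 1%N; split=> //.
  have La_ge1 : 1 <= L * a.
    by apply: le_trans (ltW lt_La); rewrite le_max lexx.
  have le_L_c0 : L <= v (c 0%N).
    rewrite expr0 mulr1 in le_dom; apply: le_trans le_dom.
    by rewrite exprS expr1 -mulrA ler_peMr // ltW.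
  have le_L2 : L ^+ 2 <= L by rewrite expr2 ler_piMr // ltW.
  apply: (le_trans (le_trans le_L2 le_L_c0)).
  by rewrite ler_peMr // le_max lexx.
- right; right; left; exists 1%N, 2%N; split=> //.
  apply: (@le_trans _ _ 1); first by apply: exprn_ile1; exact: ltW.
  by rewrite -[leLHS]mulr1; apply: ler_pM => //; rewrite le_max lexx.
Qed.
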